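(* Let $\pi:\mathfrak{G}\to\operatorname{End}(V\otimes V)$ be a groupoid parametrized Yang-Baxter equation with object map $\Delta:\mathfrak{G}\to M$, and let $m,n\geq1$. Fix $d\in M$, and let $\phi_1,\dots,\phi_m\in\mathfrak{G}$ and $\psi_1,\dots,\psi_n\in\mathfrak{G}$ be such that $\Delta(\phi_i)=d$ for all $i$ and $\Delta(\psi_j')=d$ for all $j$, so that $\gamma_{i,j}:=\phi_i\star\psi_j$ is defined for all $1\le i\le m$, $1\le j\le n$. Then for all $1\le i<m$ and $1\le j\le n$ the composition $\gamma_{i,j}\star\gamma_{i+1,j}'$ is defined and is independent of $j$. Hence both the row solvability and the column solvability requirements are satisfied by the family $(\gamma_{i,j})$: $\gamma_{i,j}\star\gamma_{i+1,j}'$ is defined and independent of $j$ for each $i<m$, and $\gamma_{i,j}'\star\gamma_{i,j+1}$ is defined and independent of $i$ for each $j<n$.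
   Context: A groupoid is a set $\mathfrak{G}$ with a partially defined composition $\star$ and an inverse map $x\mapsto x'$ such that: if $a\star b$ and $b\star c$ are defined then $(a\star b)\star c$ and $a\star(b\star c)$ are defined and equal; $a\star a'$ and $a'\star a$ are always defined; and if $a\star b$ is defined then $a\star b\star b'=a$ and $a'\star a\star b=b$. Let $V$ be a finite-dimensional vector space. For $r,s,t\in\operatorname{End}(V\otimes V)$, $\llbracket r,s,t\rrbracket=(r\otimes I_V)(I_V\otimes s)(t\otimes I_V)-(I_V\otimes t)(s\otimes I_V)(I_V\otimes r)$. A groupoid parametrized Yang-Baxter equation with object map $\Delta$ consists of a groupoid $\mathfrak{G}$, a map $\pi:\mathfrak{G}\to\operatorname{End}(V\otimes V)$, and a map $\Delta:\mathfrak{G}\to M$ to a set $M$ such that: $u\star v$ is defined if and only if $\Delta(u)=\Delta(v')$; and if $w=u\star v$ is defined then $\llbracket\pi(u),\pi(w),\pi(v)\rrbracket=0$, $\Delta(w)=\Delta(v)$ and $\Delta(w')=\Delta(u')$. The family $(\gamma_{i,j})$ labels the vertices of an $m\times n$ grid ($i$ the row, $j$ the column), the Boltzmann weights at vertex $(i,j)$ being the matrix coefficients of $\pi(\gamma_{i,j})$. *)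

(* Defs.v *)
From HB Require Import structures.
From mathcomp Require Import all_boot all_order all_algebra.

Set Implicit Arguments.
Unset Strict Implicit.
Unset Printing Implicit Defensive.

Import GRing.Theory VectorInternalTheory.
Local Open Scope ring_scope.

(* Tensor product of finite-dimensional vector spaces, coordinatised by
   matrices: u (x) w is the rank one matrix of products of coordinates.
   [lift_tens] and [tens_hom_ext] give its universal property. *)
Section Tensor.
Variable K : fieldType.
Implicit Types U V W X : vectType K.

Definition tens U W : vectType K := 'M[K]_(dim U, dim W).

Definition ptens U W (u : U) (w : W) : tens U W := (v2r u)^T *m v2r w.

Definition bilin U W X (b : U -> W -> X) : Prop :=
  (forall w, linear (fun u => b u w)) /\ (forall u, linear (b u)).

Definition std_vec U (i : 'I_(dim U)) : U := r2v (delta_mx 0 i).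

Definition lift_fun U W X (b : U -> W -> X) (A : tens U W) : X :=
  \sum_i \sum_j (A : 'M[K]_(_, _)) i j *: b (std_vec i) (std_vec j).

Fact lift_fun_linear U W X (b : U -> W -> X) : linear (lift_fun b).
Proof.
move=> a A B; rewrite /lift_fun scaler_sumr -big_split; apply: eq_bigr => i _.
rewrite scaler_sumr -big_split; apply: eq_bigr => j _ /=.
by rewrite !mxE scalerDl scalerA.
Qed.

HB.instance Definition _ U W X (b : U -> W -> X) :=
  GRing.isLinear.Build K (tens U W) X _ (lift_fun b) (lift_fun_linear b).

(* The linear map u (x) w |-> b u w; only meaningful for bilinear b. *)
Definition lift_tens U W X (b : U -> W -> X) : 'Hom(tens U W, X) :=
  linfun (lift_fun b).

(* f (x) g *)
Definition tens_map U W U' W' (f : 'Hom(U, U')) (g : 'Hom(W, W')) :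
    'Hom(tens U W, tens U' W') :=
  lift_tens (fun u w => ptens (f u) (g w)).

(* (u (x) v) (x) w |-> u (x) (v (x) w), and its inverse *)
Definition tens_assoc U V W :
    'Hom(tens (tens U V) W, tens U (tens V W)) :=
  lift_tens (fun x w => lift_tens (fun u v => ptens u (ptens v w)) x).

Definition tens_assoc_inv U V W :
    'Hom(tens U (tens V W), tens (tens U V) W) :=
  lift_tens (fun u y => lift_tens (fun v w => ptens (ptens u v) w) y).

Lemma std_vec_sum U (u : U) : u = \sum_i v2r u 0 i *: std_vec i.
Proof.
apply: v2r_inj; rewrite linear_sum /= [LHS]row_sum_delta.
by apply: eq_bigr => i _; rewrite linearZ /= r2vK.
Qed.

Lemma bilin_ptens U W : bilin (@ptens U W).
Proof.
split=> [w a u u' | u a w w']; rewrite /ptens.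
  by rewrite !linearP /= mulmxDl -scalemxAl.
by rewrite linearP /= mulmxDr -scalemxAr.
Qed.

Lemma ptensDl U W a (u u' : U) (w : W) :
  ptens (a *: u + u') w = a *: ptens u w + ptens u' w.
Proof. exact: (bilin_ptens U W).1. Qed.

Lemma ptensDr U W a (u : U) (w w' : W) :
  ptens u (a *: w + w') = a *: ptens u w + ptens u w'.
Proof. exact: (bilin_ptens U W).2. Qed.

Lemma lift_tensE U W X (b : U -> W -> X) u w :
  bilin b -> lift_tens b (ptens u w) = b u w.
Proof.
case=> bl br; rewrite lfunE /= /lift_fun.
pose bw := GRing.isLinear.Build K U X _ (b ^~ w) (bl w).
pose blin : {linear U -> X} := HB.pack (b ^~ w) bw.
have -> : b u w = blin u by [].
rewrite [in RHS](std_vec_sum u) linear_sum; apply: eq_bigr => i _.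
rewrite linearZ /=.
pose cw := GRing.isLinear.Build K W X _ (b (std_vec i)) (br _).
pose clin : {linear W -> X} := HB.pack (b (std_vec i)) cw.
have -> : b (std_vec i) w = clin w by [].
rewrite [in RHS](std_vec_sum w) linear_sum scaler_sumr; apply: eq_bigr => j _.
by rewrite linearZ /= scalerA !mxE big_ord1 mxE.
Qed.

Lemma tens_hom_ext U W X (f g : 'Hom(tens U W, X)) :
  (forall u w, f (ptens u w) = g (ptens u w)) -> f = g.
Proof.
move=> fg; apply/lfunP => A.
rewrite [A : 'M_(_, _)]matrix_sum_delta !linear_sum; apply: eq_bigr => i _.
rewrite !linear_sum; apply: eq_bigr => j _; rewrite !linearZ; congr (_ *: _).
have -> : delta_mx i j = ptens (std_vec i : U) (std_vec j : W).
  by rewrite /ptens !r2vK trmx_delta mul_delta_mx.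
exact: fg.
Qed.

Lemma tens_mapE U W U' W' (f : 'Hom(U, U')) (g : 'Hom(W, W')) u w :
  tens_map f g (ptens u w) = ptens (f u) (g w).
Proof.
by apply: lift_tensE; split=> [y a x x' | x a y y'];
  rewrite linearP ?ptensDl ?ptensDr.
Qed.

Lemma tens_assocE U V W (u : U) (v : V) (w : W) :
  tens_assoc U V W (ptens (ptens u v) w) = ptens u (ptens v w).
Proof.
have bA w' : bilin (fun (u : U) (v : V) => ptens u (ptens v w')).
  by split=> [y a x x' | x a y y']; rewrite !(ptensDl, ptensDr).
rewrite lift_tensE ?lift_tensE //.
split=> [w' a x x' | x a w1 w2]; first by rewrite linearP.
rewrite -[X in _ = X + _]scale_lfunE -add_lfunE; congr (fun_of_lfun _ x).
apply: tens_hom_ext => u' v'.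
by rewrite add_lfunE scale_lfunE !lift_tensE // !ptensDr.
Qed.

Lemma tens_assoc_invE U V W (u : U) (v : V) (w : W) :
  tens_assoc_inv U V W (ptens u (ptens v w)) = ptens (ptens u v) w.
Proof.
have bA u' : bilin (fun (v : V) (w : W) => ptens (ptens u' v) w).
  by split=> [y a x x' | x a y y']; rewrite !(ptensDl, ptensDr).
rewrite lift_tensE ?lift_tensE //.
split=> [x a u1 u2 | u' a x x']; last by rewrite linearP.
rewrite -[X in _ = X + _]scale_lfunE -add_lfunE; congr (fun_of_lfun _ x).
apply: tens_hom_ext => v' w'.
by rewrite add_lfunE scale_lfunE !lift_tensE // !ptensDl.
Qed.

End Tensor.

Section YangBaxter.
Variables (K : fieldType) (V : vectType K).
Local Notation V2 := (tens V V).
Local Notation V3 := (tens (tens V V) V).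

(* r (x) I_V *)
Definition act12 (r : 'End(V2)) : 'End(V3) := tens_map r \1%VF.

(* I_V (x) r, transported to (V (x) V) (x) V *)
Definition act23 (r : 'End(V2)) : 'End(V3) :=
  (tens_assoc_inv V V V \o tens_map \1%VF r \o tens_assoc V V V)%VF.

Definition yb_bracket (r s t : 'End(V2)) : 'End(V3) :=
  (act12 r \o act23 s \o act12 t)%VF - (act23 t \o act12 s \o act23 r)%VF.

Lemma yb_bracketE r s t x :
  yb_bracket r s t x =
  act12 r (act23 s (act12 t x)) - act23 t (act12 s (act23 r x)).
Proof. by rewrite add_lfunE opp_lfunE !comp_lfunE. Qed.

Lemma act12E r (x : V2) (w : V) : act12 r (ptens x w) = ptens (r x) w.
Proof. by rewrite tens_mapE id_lfunE. Qed.

Lemma act23E r (u v w : V) :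
  act23 r (ptens (ptens u v) w) =
  tens_assoc_inv V V V (ptens u (r (ptens v w))).
Proof. by rewrite !comp_lfunE tens_assocE tens_mapE id_lfunE. Qed.

End YangBaxter.

(* [gop a b = None] means that a * b is not defined. *)
Record groupoid : Type := Groupoid {
  gsort :> Type;
  gop : gsort -> gsort -> option gsort;
  ginv : gsort -> gsort;
  gopA : forall a b c ab bc, gop a b = Some ab -> gop b c = Some bc ->
    exists abc, gop ab c = Some abc /\ gop a bc = Some abc;
  gopV : forall a, gop a (ginv a) <> None;
  gopVl : forall a, gop (ginv a) a <> None;
  (* a * b * b' and a' * a * b have the same value for both bracketings,
     by gopA, gopV and gopVl. *)
  gopK : forall a b ab, gop a b = Some ab -> gop ab (ginv b) = Some a;
  gopKl : forall a b ab, gop a b = Some ab -> gop (ginv a) ab = Some b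
}.

Definition composable (G : groupoid) (a b : G) : Prop :=
  exists c, gop a b = Some c.

Record groupoid_ybe (K : fieldType) (V : vectType K) (G : groupoid) (M : Type)
    (pi : G -> 'End(tens V V)) (Delta : G -> M) : Prop := GroupoidYBE {
  ybe_composable : forall u v : G,
    composable u v <-> Delta u = Delta (ginv v);
  ybe_eq : forall u v w : G,
    gop u v = Some w -> yb_bracket (pi u) (pi w) (pi v) = 0;
  ybe_target : forall u v w : G, gop u v = Some w -> Delta w = Delta v;
  ybe_source : forall u v w : G,
    gop u v = Some w -> Delta (ginv w) = Delta (ginv u)
}.

Section Solvable.
Variables (G : groupoid) (m n : nat) (gamma : 'I_m -> 'I_n -> G).

Definition row_solvable : Prop :=
  forall i i' : 'I_m, i' = i.+1 :> nat ->
    (forall j, composable (gamma i j) (ginv (gamma i' j))) /\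
    (forall j1 j2, gop (gamma i j1) (ginv (gamma i' j1)) =
                   gop (gamma i j2) (ginv (gamma i' j2))).

Definition column_solvable : Prop :=
  forall j j' : 'I_n, j' = j.+1 :> nat ->
    (forall i, composable (ginv (gamma i j)) (gamma i j')) /\
    (forall i1 i2, gop (ginv (gamma i1 j)) (gamma i1 j') =
                   gop (ginv (gamma i2 j)) (gamma i2 j')).

End Solvable.

(* Main.v *)
(* In a groupoid, (a * b) * (c * b)' = a * c' and (a * b)' * (a * c) = b' * c.
   Hence the row and column compositions are phi_i * phi_{i+1}' and
   psi_j' * psi_{j+1}, which no longer involve the other index. *)
Require Import Defs.
From mathcomp Require Import all_boot all_order all_algebra.

(** Three cancellations in turn: [a * b = c] gives [c * b' = a], then [c' * a = b'], then
    [b' * a' = c']. *)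
Lemma gop_inv {G : groupoid} {a b c : G} :
  gop a b = Some c -> gop (ginv b) (ginv a) = Some (ginv c).
Proof. by move=> ab; exact: gopK (gopKl (gopK ab)). Qed.

(** Associativity for the triple [x, b', c']: here [x * b' = a] and [b' * c' = y'], so both
    bracketings are defined and agree. *)
Lemma gop_cancelr {G : groupoid} {a b c x y : G} :
  gop a b = Some x -> gop c b = Some y ->
  exists z, gop a (ginv c) = Some z /\ gop x (ginv y) = Some z.
Proof. by move=> ab cb; exact: gopA (gopK ab) (gop_inv cb). Qed.

(** Associativity for the triple [b', a', y], with [b' * a' = x'] and [a' * y = c]. *)
Lemma gop_cancell {G : groupoid} {a b c x y : G} :
  gop a b = Some x -> gop a c = Some y ->
  exists z, gop (ginv x) y = Some z /\ gop (ginv b) c = Some z.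
Proof. by move=> ab ac; exact: gopA (gop_inv ab) (gopKl ac). Qed.

Theorem proposition8p4 (K : fieldType) (V : vectType K) (G : groupoid)
    (M : Type) (pi : G -> 'End(tens V V)) (Delta : G -> M)
    (ybe : groupoid_ybe pi Delta)
    (m n : nat) (m_ge1 : 1 <= m) (n_ge1 : 1 <= n)
    (d : M) (phi : 'I_m -> G) (psi : 'I_n -> G)
    (phi_d : forall i, Delta (phi i) = d)
    (psi_d : forall j, Delta (ginv (psi j)) = d) :
  (forall i j, composable (phi i) (psi j)) /\
  (forall gamma : 'I_m -> 'I_n -> G,
     (forall i j, gop (phi i) (psi j) = Some (gamma i j)) ->
     row_solvable gamma /\ column_solvable gamma).
Proof.
split=> [i j | gamma gammaE].
  by apply/(ybe_composable ybe); rewrite phi_d psi_d.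
split.
  move=> i i' _; split=> [j | j1 j2].
    by have [z [_ ?]] := gop_cancelr (gammaE i j) (gammaE i' j); exists z.
  (* Each side is traded for [gop (phi i) (ginv (phi i'))], in which no column index is left. *)
  have [z1 [<- ->]] := gop_cancelr (gammaE i j1) (gammaE i' j1).
  by have [z2 [<- ->]] := gop_cancelr (gammaE i j2) (gammaE i' j2).
move=> j j' _; split=> [i | i1 i2].
  by have [z [? _]] := gop_cancell (gammaE i j) (gammaE i j'); exists z.
(* Here the common value is [gop (ginv (psi j)) (psi j')]. *)
have [z1 [-> <-]] := gop_cancell (gammaE i1 j) (gammaE i1 j').
by have [z2 [-> <-]] := gop_cancell (gammaE i2 j) (gammaE i2 j').
Qed.
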